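(* Let $n_1,\dots,n_M$ and $T$ be sufficiently smooth scalar fields on a domain in $\mathbb R^d$, let $f_b(\boldsymbol n,T)$ and $c_{ij}(\boldsymbol n,T)=c_{ji}(\boldsymbol n,T)$ be sufficiently smooth functions of $\boldsymbol n=(n_1,\dots,n_M)$ and $T$, and let the chemical potentials $\mu_i$, entropy density $s$ and pressure $p$ be those defined in the context from the Helmholtz free energy density $f=f_b+\frac12\sum_{i,j=1}^M c_{ij}\nabla n_i\cdot\nabla n_j$. Then $$\nabla p+\sum_{i,j=1}^M\nabla\cdot\big(c_{ij}\nabla n_i\otimes\nabla n_j\big)=\sum_{i=1}^M n_i\nabla\mu_i+s\nabla T .$$
   Context: The Helmholtz free energy density of an $M$-component inhomogeneous fluid with molar densities $\boldsymbol n=(n_1,\dots,n_M)$ and temperature $T$ is $f(\boldsymbol n,T)=f_b(\boldsymbol n,T)+f_\nabla(\boldsymbol n,T)$, with $f_b$ the bulk free energy density and $f_\nabla(\boldsymbol n,T)=\frac12\sum_{i,j=1}^M c_{ij}(\boldsymbol n,T)\nabla n_i\cdot\nabla n_j$, where $c_{ij}$ are the (symmetric) cross influence parameters. The chemical potential of component $i$ is the variational derivative $\mu_i=\delta f/\delta n_i$ (with $T$ and the other densities fixed), i.e. $$\mu_i=\mu_i^b-\sum_{j=1}^M\nabla\cdot(c_{ij}\nabla n_j)+\frac12\sum_{j,k=1}^M\frac{\partial c_{jk}}{\partial n_i}\nabla n_j\cdot\nabla n_k,\qquad \mu_i^b=\frac{\partial f_b}{\partial n_i}(\boldsymbol n,T).$$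 The entropy density is $s=-(\delta f/\delta T)_{\boldsymbol n}$, i.e. $s=-\frac{\partial f_b}{\partial T}-\frac12\sum_{i,j=1}^M\frac{\partial c_{ij}}{\partial T}\nabla n_i\cdot\nabla n_j$. The pressure is $p=\sum_{i=1}^M\mu_in_i-f$, i.e. $$p=p_b-\sum_{i,j=1}^M n_i\nabla\cdot(c_{ij}\nabla n_j)+\frac12\sum_{i,j,k=1}^M n_i\frac{\partial c_{jk}}{\partial n_i}\nabla n_j\cdot\nabla n_k-\frac12\sum_{i,j=1}^M c_{ij}\nabla n_i\cdot\nabla n_j,\qquad p_b=\sum_{i=1}^M n_i\mu_i^b-f_b.$$ The divergence of a tensor field $A$ is the vector field with components $\sum_b\partial_b A_{ab}$ (the sum over $i,j$ above gives a symmetric tensor, so the index convention is immaterial). *)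

(* Defs.v *)
From HB Require Import structures.
From mathcomp Require Import all_boot all_order all_algebra.
From mathcomp Require Import all_classical all_reals all_analysis.

Set Implicit Arguments.
Unset Strict Implicit.
Unset Printing Implicit Defensive.

Import Order.TTheory GRing.Theory Num.Theory.
Import numFieldNormedType.Exports.

Local Open Scope classical_set_scope.
Local Open Scope ring_scope.

(* For V finite-dimensional and U open this is the usual class C^k(U): since
   'D_v is linear in v for differentiable functions, asking for the derivatives
   along all v amounts to asking for the partial derivatives. *)
Fixpoint Ck (R : realType) (V : normedModType R) (k : nat) (U : set V)
    (f : V -> R) : Prop :=
  if k is j.+1 then
    (forall x, U x -> differentiable f x) /\ (forall v, Ck j U ('D_v f))
  else forall x, U x -> {for x, continuous f}.

Section VectorCalculus.
Variables (R : realType) (d : nat).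
Implicit Types (f : 'rV[R]_d -> R) (u v x : 'rV[R]_d).

Definition partial (a : 'I_d) f x : R := 'D_(delta_mx 0 a) f x.

Definition grad f x : 'rV[R]_d := \row_a partial a f x.

Definition dot u v : R := \sum_(a < d) u 0 a * v 0 a.

Definition outer u v : 'M[R]_d := \matrix_(a, b) (u 0 a * v 0 b).

Definition div (w : 'rV[R]_d -> 'rV[R]_d) x : R :=
  \sum_(a < d) partial a (fun y => w y 0 a) x.

Definition tensor_div (A : 'rV[R]_d -> 'M[R]_d) x : 'rV[R]_d :=
  \row_a \sum_(b < d) partial b (fun y => A y a b) x.

End VectorCalculus.

Section DeriveSum.
Variables (R : realType) (V : normedModType R).

Lemma is_derive_bigsum k (f : 'I_k -> V -> R) (df : 'I_k -> R) (x v : V) :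
  (forall i, is_derive x v (f i) (df i)) ->
  is_derive x v (fun y => \sum_(i < k) f i y) (\sum_(i < k) df i).
Proof.
move=> H; have -> : (fun y => \sum_(i < k) f i y) = \sum_(i < k) f i.
  by apply/funext => y; rewrite fct_sumE.
exact: is_derive_sum.
Qed.

Lemma is_derive_mull (a df : R) (f : V -> R) (x v : V) :
  is_derive x v f df -> is_derive x v (fun y => a * f y) (a * df).
Proof. exact: is_deriveZ. Qed.

Lemma is_derive_mulr (a df : R) (f : V -> R) (x v : V) :
  is_derive x v f df -> is_derive x v (fun y => f y * a) (df * a).
Proof.
move=> H; rewrite mulrC.
have -> : (fun y => f y * a) = (fun y => a * f y).
  by apply/funext => y; rewrite mulrC.
exact: is_derive_mull.
Qed.

End DeriveSum.

Section Fluid.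
Variables (R : realType) (M d : nat).

(* a pair (densities, temperature) *)
Notation state := ('rV[R]_M * R)%type.

Definition d_dn (i : 'I_M) (g : state -> R) (z : state) : R :=
  'D_((delta_mx 0 i, 0) : state) g z.

Definition d_dT (g : state -> R) (z : state) : R :=
  'D_((0, 1) : state) g z.

(* The free energy density as a function of (n, T) and of the matrix G whose
   i-th row stands for the gradient of n_i. *)
Definition helmholtz (fb : state -> R) (c : 'I_M -> 'I_M -> state -> R)
    (z : state) (G : 'M[R]_(M, d)) : R :=
  fb z + 2^-1 * \sum_(i < M) \sum_(j < M) c i j z * dot (row i G) (row j G).

Section Fields.
Variables (F : state -> 'M[R]_(M, d) -> R).
Variables (n : 'I_M -> 'rV[R]_d -> R) (T : 'rV[R]_d -> R).

Definition state_at (x : 'rV[R]_d) : state := (\row_i n i x, T x).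

Definition grads_at (x : 'rV[R]_d) : 'M[R]_(M, d) := \matrix_i grad (n i) x.

(* dF/d(grad n_i) along the fields *)
Definition flux (i : 'I_M) (x : 'rV[R]_d) : 'rV[R]_d :=
  \row_a 'D_(delta_mx i a) (F (state_at x)) (grads_at x).

(* The variational derivative of the integral of F(n, T, grad n) with respect
   to n_i, i.e. dF/dn_i - div (dF/d(grad n_i)). *)
Definition chemical_potential (i : 'I_M) (x : 'rV[R]_d) : R :=
  d_dn i (F^~ (grads_at x)) (state_at x) - div (flux i) x.

(* F does not involve grad T, so its variational derivative with respect to T
   is the partial derivative. *)
Definition entropy (x : 'rV[R]_d) : R :=
  - d_dT (F^~ (grads_at x)) (state_at x).

Definition pressure (x : 'rV[R]_d) : R :=
  \sum_(i < M) chemical_potential i x * n i x - F (state_at x) (grads_at x).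

End Fields.

Section Explicit.
Variables (fb : state -> R) (c : 'I_M -> 'I_M -> state -> R).
Variables (n : 'I_M -> 'rV[R]_d -> R) (T : 'rV[R]_d -> R).
Variables (U : set 'rV[R]_d) (V : set state).
Hypothesis openU : open U.
Hypothesis UV : forall x, U x -> V (state_at n T x).
Hypothesis c_sym : forall i j z, V z -> c i j z = c j i z.
Hypothesis n_C2 : forall i, Ck 2 U (n i).
Hypothesis T_C1 : Ck 1 U T.
Hypothesis fb_C1 : Ck 1 V fb.
Hypothesis c_C1 : forall i j, Ck 1 V (c i j).

Let F := helmholtz fb c.
Let z := state_at n T.

Lemma derive_helmholtz_state (v w : state) (G : 'M[R]_(M, d)) :
  V w -> 'D_v (F^~ G) w = 'D_v fb w + 2^-1 *
    \sum_(i < M) \sum_(j < M) 'D_v (c i j) w * dot (row i G) (row j G).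
Proof.
move=> Vw; apply: (@derive_val _ _ _ _ _ (F^~ G)); apply: is_deriveD.
  exact/derivableP/diff_derivable/fb_C1.1.
apply: is_derive_mull; apply: is_derive_bigsum => i.
apply: is_derive_bigsum => j; apply: is_derive_mulr.
exact/derivableP/diff_derivable/(c_C1 i j).1.
Qed.

Lemma is_derive_entry (G e : 'M[R]_(M, d)) j b :
  is_derive G e (fun H : 'M[R]_(M, d) => H j b) (e j b).
Proof.
have dG : derivable id G e by exact: derivable_id.
apply: DeriveDef; first by move/derivable_mxP : dG; exact.
have := derive_mx dG; rewrite derive_id => /matrixP/(_ j b).
by rewrite mxE => <-.
Qed.

Lemma derive_helmholtz_grad (w : state) (G : 'M[R]_(M, d)) i a :
  'D_(delta_mx i a) (F w) G =
    2^-1 * \sum_(j < M) (c i j w + c j i w) * G j a.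
Proof.
set e : 'M[R]_(M, d) := delta_mx i a.
have -> : 'D_e (F w) G = 0 + 2^-1 * \sum_(j < M) \sum_(k < M) c j k w *
    \sum_(b < d) (G j b * e k b + G k b * e j b).
  apply: (@derive_val _ _ _ _ _ (F w)).
  apply: (@is_deriveD _ _ _ (cst (fb w)) (fun H => 2^-1 * \sum_(j < M)
    \sum_(k < M) c j k w * dot (row j H) (row k H))).
  apply: is_derive_mull; apply: is_derive_bigsum => j.
  apply: is_derive_bigsum => k; apply: is_derive_mull.
  rewrite /dot; under eq_fun do under eq_bigr do rewrite !mxE.
  apply: is_derive_bigsum => b.
  by apply: is_deriveM; exact: is_derive_entry.
rewrite add0r; congr (_ * _).
have E j (H : 'M[R]_(M, d)) k :
    \sum_(b < d) H j b * e k b = (k == i)%:R * H j a.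
  rewrite (bigD1 a)//= big1 ?addr0 => [|b /negbTE ba].
    by rewrite !mxE eqxx andbT mulrC.
  by rewrite !mxE ba andbF mulr0.
under eq_bigr do under eq_bigr do rewrite big_split !E mulrDr.
under eq_bigr do rewrite big_split /=.
rewrite big_split /= addrC; under [RHS]eq_bigr do rewrite mulrDl.
rewrite big_split /=; congr (_ + _).
  rewrite (bigD1 i)//= [X in _ + X]big1 ?addr0 => [|j /negbTE ji].
    by apply: eq_bigr => k _; rewrite eqxx mul1r.
  by rewrite big1// => k _; rewrite ji mul0r mulr0.
apply: eq_bigr => j _; rewrite (bigD1 i)//= big1 ?addr0 => [|k /negbTE ki].
  by rewrite eqxx mul1r.
by rewrite ki mul0r mulr0.
Qed.

Lemma fluxE i x : U x ->
  flux F n T i x = \sum_(j < M) c i j (z x) *: grad (n j) x.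
Proof.
move=> Ux; apply/rowP => a; rewrite mxE derive_helmholtz_grad summxE.
rewrite mulr_sumr; apply: eq_bigr => j _.
rewrite (c_sym j i); last exact: UV.
by rewrite !mxE -mulr2n mulrnAl -[(_ * _) *+ 2]mulr_natl mulKf// pnatr_eq0.
Qed.

Lemma differentiable_state_at x : U x -> differentiable (state_at n T) x.
Proof.
move=> Ux; apply: differentiable_pair; last exact: T_C1.1.
have -> : (fun y => \row_i n i y) =
    \sum_(i < M) (fun y => n i y *: (delta_mx 0 i : 'rV[R]_M)).
  apply/funext => y; rewrite fct_sumE [LHS]row_sum_delta.
  by apply: eq_bigr => i _; rewrite mxE.
apply: differentiable_sum => i; apply: differentiableZl.
exact: (n_C2 i).1.
Qed.

Lemma div_fluxE i x : U x ->
  div (flux F n T i) x =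
    \sum_(j < M) div (fun y => c i j (z y) *: grad (n j) y) x.
Proof.
move=> Ux; rewrite /div exchange_big /=; apply: eq_bigr => a _.
rewrite /partial (@near_eq_derive _ _ _ _
  (fun y => \sum_(j < M) (c i j (z y) *: grad (n j) y) 0 a)).
  apply: derive_val; apply: is_derive_bigsum => j; apply: derivableP.
  under eq_fun do rewrite !mxE.
  apply: derivableM; apply: diff_derivable; last first.
    exact: ((n_C2 j).2 _).1.
  apply: differentiable_comp; first exact: differentiable_state_at.
  exact/(c_C1 i j).1/UV.
by near do rewrite fluxE ?summxE//; exact: open_nbhs_nbhs.
Unshelve. all: by end_near. Qed.

Lemma chemical_potentialE i x : U x ->
  chemical_potential F n T i x =
    d_dn i fb (z x)
    - \sum_(j < M) div (fun y => c i j (z y) *: grad (n j) y) x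
    + 2^-1 * \sum_(j < M) \sum_(k < M)
        d_dn i (c j k) (z x) * dot (grad (n j) x) (grad (n k) x).
Proof.
move=> Ux; rewrite /chemical_potential div_fluxE// addrAC; congr (_ - _).
rewrite /d_dn derive_helmholtz_state; last exact: UV.
congr (_ + _ * _); apply: eq_bigr => j _; apply: eq_bigr => k _.
by rewrite !rowK.
Qed.

Lemma entropyE x : U x ->
  entropy F n T x = - d_dT fb (z x) - 2^-1 * \sum_(i < M) \sum_(j < M)
    d_dT (c i j) (z x) * dot (grad (n i) x) (grad (n j) x).
Proof.
move=> Ux; rewrite /entropy /d_dT derive_helmholtz_state; last exact: UV.
rewrite opprD; congr (_ - _ * _); apply: eq_bigr => i _.
by apply: eq_bigr => j _; rewrite !rowK.
Qed.

Lemma pressureE x : U x ->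
  pressure F n T x = (\sum_(i < M) n i x * d_dn i fb (z x) - fb (z x))
    - \sum_(i < M) \sum_(j < M)
        n i x * div (fun y => c i j (z y) *: grad (n j) y) x
    + 2^-1 * \sum_(i < M) \sum_(j < M) \sum_(k < M)
        n i x * d_dn i (c j k) (z x) * dot (grad (n j) x) (grad (n k) x)
    - 2^-1 * \sum_(i < M) \sum_(j < M)
        c i j (z x) * dot (grad (n i) x) (grad (n j) x).
Proof.
move=> Ux; rewrite /pressure.
under eq_bigr => i _.
  rewrite chemical_potentialE// mulrDl mulrBl mulr_suml -mulrA mulr_suml.
  over.
rewrite big_split sumrB /= -mulr_sumr /F /helmholtz opprD !addrA.
congr (_ - _ * _); last first.
  by apply: eq_bigr => i _; apply: eq_bigr => j _; rewrite !rowK.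
rewrite addrAC; congr (_ + _ * _); last first.
  apply: eq_bigr => i _; apply: eq_bigr => j _; rewrite mulr_suml.
  by apply: eq_bigr => k _; rewrite mulrC mulrA.
rewrite addrAC; congr (_ - _ - _).
  by apply: eq_bigr => i _; rewrite mulrC.
by apply: eq_bigr => i _; apply: eq_bigr => j _; rewrite mulrC.
Qed.

End Explicit.
End Fluid.

(* Main.v *)
Require Import Defs.
From HB Require Import structures.
From mathcomp Require Import all_boot all_order all_algebra.
From mathcomp Require Import all_classical all_reals all_analysis.
From mathcomp Require Import ring lra.

Import Order.TTheory GRing.Theory Num.Theory.
Import numFieldNormedType.Exports.

Local Open Scope classical_set_scope.
Local Open Scope ring_scope.

(** For F(n, T, grad n) with fluxes q_i = dF/d(grad n_i), the chain rule gives
    grad F = sum_i (dF/dn_i grad n_i + Hess(n_i) q_i) + dF/dT grad T.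
    With mu_i = dF/dn_i - div q_i, s = - dF/dT and p = sum_i mu_i n_i - F this is
    grad p = sum_i n_i grad mu_i + s grad T
             - sum_i (div q_i grad n_i + Hess(n_i) q_i).
    Since q_i = sum_j c_ij grad n_j, the product rule and the symmetry of the
    Hessians identify the last sum with the divergence of
    sum_ij c_ij grad n_i (x) grad n_j. *)

(** * Smoothness classes and derivatives of finite sums *)

Lemma Ck_continuous (R : realType) (V : normedModType R) k (U : set V)
    (f : V -> R) x : Ck k U f -> U x -> {for x, continuous f}.
Proof.
case: k => [|k] /=; first by move=> + Ux; apply.
by case=> + _ Ux => /(_ _ Ux); exact: differentiable_continuous.
Qed.

(** The induction passes to the directional derivatives; at the bottom, differentiability yields
    continuity. *)
Lemma CkS {R : realType} {V : normedModType R} {k} {U : set V} {f : V -> R} :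
  Ck k.+1 U f -> Ck k U f.
Proof.
elim: k f => [f fC x|k IH f [df Df]]; first exact: (@Ck_continuous _ _ 1%N).
by split => // v; apply/IH/Df.
Qed.

Lemma derivable_bigsum (R : realType) (V : normedModType R) k
    (f : 'I_k -> V -> R) (x v : V) :
  (forall i, derivable (f i) x v) ->
  derivable (fun y => \sum_(i < k) f i y) x v.
Proof.
move=> df; apply: ex_derive; apply: is_derive_bigsum => i.
exact/derivableP/df.
Qed.

(** * Symmetry of second directional derivatives (Schwarz) *)

Section SymmetryOfSecondDerivatives.
Set Implicit Arguments.
Unset Strict Implicit.
Variables (R : realType) (V : normedModType R).
Implicit Types (f : V -> R) (x u v w : V).

(** Both difference quotients are the same function of [h], so existence and value transfer at
    once. *)
Lemma is_derive_line f x u (s : R) : derivable f (x + s *: u) u ->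
  is_derive s 1 (fun t => f (x + t *: u)) ('D_u f (x + s *: u)).
Proof.
move=> df; have E : (fun h : R => h^-1 *: (((fun t => f (x + t *: u)) \o
    shift s) (h *: (1 : R)) - f (x + s *: u))) =
    (fun h : R => h^-1 *: ((f \o shift (x + s *: u)) (h *: u)
       - f (x + s *: u))).
  apply/funext => h /=; congr (_ *: (f _ - _)).
  by rewrite [h *: _](mulr1 h) scalerDl addrCA.
by apply: DeriveDef; rewrite /derivable /derive E.
Qed.

Lemma is_derive_translate f x u w : derivable f (x + w) u ->
  is_derive x u (fun y => f (y + w)) ('D_u f (x + w)).
Proof.
move=> df; have E : (fun h : R => h^-1 *: (((fun y => f (y + w)) \o
    shift x) (h *: u) - f (x + w))) =
    (fun h : R => h^-1 *: ((f \o shift (x + w)) (h *: u) - f (x + w))).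
  by apply/funext => h /=; rewrite addrA.
by apply: DeriveDef; rewrite /derivable /derive E.
Qed.

Lemma MVT_line f x u (h : R) : 0 < h ->
  (forall t, 0 <= t <= h -> derivable f (x + t *: u) u) ->
  exists2 t, 0 <= t <= h & f (x + h *: u) - f x = h * 'D_u f (x + t *: u).
Proof.
move=> h0 df.
pose g (t : R) : R := f (x + t *: u); pose dg (t : R) : R := 'D_u f (x + t *: u).
have gP (t : R) : t \in `[0, h] -> is_derive t 1 g (dg t).
  by rewrite in_itv => /df; exact: is_derive_line.
have gc : {within `[0, h], continuous g}.
  by apply: derivable_within_continuous => t th; have [] := gP t th.
have gP' (t : R) : t \in `]0, h[ -> is_derive t 1 g (dg t).
  by move=> th; apply: gP; exact: subset_itv_oo_cc th.
have [t th] := MVT h0 gP' gc.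
rewrite /g scale0r addr0 subr0 mulrC => ->; exists t => //.
by have := subset_itv_oo_cc th; rewrite in_itv.
Qed.

(** The mean value theorem is used twice: along [u] for the increment [f (y + h *: v) - f y], then
    along [v] for ['D_u f], starting from [x + s *: u]. *)
Lemma second_difference f x u v (h : R) : 0 < h ->
  (forall s t, 0 <= s <= h -> 0 <= t <= h ->
     derivable f (x + s *: u + t *: v) u /\
     derivable ('D_u f) (x + s *: u + t *: v) v) ->
  exists s t, [/\ 0 <= s <= h, 0 <= t <= h &
    f (x + h *: u + h *: v) - f (x + h *: v) - f (x + h *: u) + f x
    = h ^+ 2 * 'D_v ('D_u f) (x + s *: u + t *: v)].
Proof.
move=> h0 df.
have hh : 0 <= h <= h by rewrite ltW//=.
have h00 : 0 <= (0 : R) <= h by rewrite lexx ltW.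
have dg s : 0 <= s <= h -> is_derive (x + s *: u) u
    (fun y => f (y + h *: v) - f y)
    ('D_u f (x + s *: u + h *: v) - 'D_u f (x + s *: u)).
  move=> sh; apply: is_deriveB.
    by apply: is_derive_translate; exact: (df s h sh hh).1.
  by apply/derivableP; have := (df s 0 sh h00).1; rewrite scale0r addr0.
have [s sh E1] := @MVT_line _ x u h h0 (fun s sh => ex_derive (is_derive := dg s sh)).
have [t th E2] := @MVT_line ('D_u f) (x + s *: u) v h h0
  (fun t th => (df s t sh th).2).
exists s, t; split => //.
(* The second difference is regrouped as the increment along [u] of the increment along [v]. *)
have -> : f (x + h *: u + h *: v) - f (x + h *: v) - f (x + h *: u) + f x =
  f (x + h *: u + h *: v) - f (x + h *: u) - (f (x + h *: v) - f x) by ring.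
by rewrite E1 (derive_val (is_derive := dg s sh)) E2 mulrA.
Qed.

Lemma near_parallelogram (P : set V) x u v : nbhs x P ->
  exists2 r : R, 0 < r & forall s t, 0 <= s <= r -> 0 <= t <= r ->
    P (x + s *: u + t *: v).
Proof.
move=> xP.
have lin : (fun p : R * R => x + p.1 *: u + p.2 *: v) @ ((0, 0) : R * R) --> x.
  rewrite -[X in _ --> X](_ : x + 0 *: u + 0 *: v = _); last first.
    by rewrite !scale0r !addr0.
  apply: cvgD; [apply: cvgD; first exact: cvg_cst|].
    by apply: cvgZr_tmp; exact: cvg_fst.
  by apply: cvgZr_tmp; exact: cvg_snd.
have /nbhs_ballP[r /= r0 rP] := lin _ xP.
(* The ball is open while [s] and [t] range over closed intervals; halving the radius keeps the
   endpoints inside. *)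
exists (r / 2); first by rewrite divr_gt0.
move=> s t sr tr; apply: (rP (s, t)); split; rewrite /= /ball /= sub0r normrN.
  by rewrite ger0_norm; lra.
by rewrite ger0_norm; lra.
Qed.

(** The points [y] and [z] may differ: the mean value theorem gives unrelated intermediate points
    for the two orders of differentiation. *)
Lemma continuous_eq_at (g h : V -> R) x :
  {for x, continuous g} -> {for x, continuous h} ->
  (forall P, nbhs x P -> exists y z, [/\ P y, P z & g y = h z]) ->
  g x = h x.
Proof.
move=> gx hx gh; apply/eqP; rewrite -subr_eq0 -normr_le0.
apply/ler_addgt0Pr => e e0; rewrite add0r.
have e2 : 0 < e / 2 by rewrite divr_gt0.
have gxe : \forall y \near x, `|g x - g y| < e / 2.
  by move/cvgr_dist_lt : gx; exact.
have hxe : \forall y \near x, `|h x - h y| < e / 2.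
  by move/cvgr_dist_lt : hx; exact.
have [y [z [[A _] [_ B] E]]] := gh _ (filterI gxe hxe).
rewrite -(subrKA (g y)) (le_trans (ler_normD _ _))// [leRHS](splitr e).
by rewrite lerD// ltW// E distrC.
Qed.

(** The second difference over a small parallelogram is symmetric in [u] and [v], and equals
    [r ^+ 2] times either mixed derivative at some point of it. Continuity at [x] then identifies
    the two values. *)
Lemma derive_symmetric f x u v :
  (\forall y \near x, derivable f y u /\ derivable ('D_u f) y v) ->
  (\forall y \near x, derivable f y v /\ derivable ('D_v f) y u) ->
  {for x, continuous ('D_v ('D_u f))} -> {for x, continuous ('D_u ('D_v f))} ->
  'D_v ('D_u f) x = 'D_u ('D_v f) x.
Proof.
move=> fuv fvu cvu cuv; apply: (continuous_eq_at cvu cuv) => P xP.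
have [r r0 rP] := near_parallelogram u v (filterI xP (filterI fuv fvu)).
have [s [t [sr tr E1]]] := @second_difference f x u v _ r0
  (fun s t sr tr => (rP s t sr tr).2.1).
have rP' s' t' (sr' : 0 <= s' <= r) (tr' : 0 <= t' <= r) :=
  rP t' s' tr' sr'.
have [|s' [t' [sr' tr' E2]]] := @second_difference f x v u _ r0.
  by move=> s' t' sr' tr'; rewrite addrAC; exact (rP' s' t' sr' tr').2.2.
exists (x + s *: u + t *: v), (x + s' *: v + t' *: u); split.
- exact (rP s t sr tr).1.
- by rewrite addrAC; exact (rP' s' t' sr' tr').1.
have rr0 : r ^+ 2 != 0 by rewrite expf_neq0// gt_eqF.
apply: (mulfI rr0); apply: etrans (etrans (esym E1) _) E2.
by rewrite (addrAC x (r *: v) (r *: u)); congr (_ + _); exact: addrAC.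
Qed.

Lemma Ck_derive_symmetric f (U : set V) x u v : open U -> Ck 2 U f -> U x ->
  'D_v ('D_u f) x = 'D_u ('D_v f) x.
Proof.
move=> oU fC2 Ux; have nU : \forall y \near x, U y by exact: open_nbhs_nbhs.
have H u' v' : \forall y \near x,
    derivable f y u' /\ derivable ('D_u' f) y v'.
  near=> y; have Uy : U y by near: y.
  split; apply: diff_derivable; first exact: fC2.1.
  exact: (fC2.2 _).1.
apply: derive_symmetric => //.
  exact: ((fC2.2 u).2 v x Ux).
exact: ((fC2.2 v).2 u x Ux).
Unshelve. all: by end_near. Qed.

End SymmetryOfSecondDerivatives.

(** * Chain rule through the state of the fluid *)

Section Fluid.
Set Implicit Arguments.
Unset Strict Implicit.
Variables (R : realType) (M d : nat).
Notation state := ('rV[R]_M * R)%type.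
Variables (n : 'I_M -> 'rV[R]_d -> R) (T : 'rV[R]_d -> R).
Variable U : set 'rV[R]_d.
Hypothesis n_C2 : forall i, Ck 2 U (n i).
Hypothesis T_C1 : Ck 1 U T.

Let z := state_at n T.

Lemma derive_state_at x v : U x ->
  'D_v z x = (\row_i 'D_v (n i) x, 'D_v T x).
Proof.
move=> Ux.
have dn : differentiable (fun y => \row_i n i y) x.
  have -> : (fun y => \row_i n i y) =
      \sum_(i < M) (fun y => n i y *: (delta_mx 0 i : 'rV[R]_M)).
    apply/funext => y; rewrite fct_sumE [LHS]row_sum_delta.
    by apply: eq_bigr => i _; rewrite mxE.
  apply: differentiable_sum => i; apply: differentiableZl.
  exact: (n_C2 i).1.
have dT : differentiable T x by exact: T_C1.1.
have dz : differentiable z x by exact: differentiable_pair.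
rewrite (deriveE _ dz) diff_pair// -(deriveE _ dn) -(deriveE _ dT).
rewrite derive_mx; last exact: diff_derivable.
congr (_, _); apply/rowP => i; rewrite !mxE; congr ('D_v _ x).
by apply/funext => y; rewrite mxE.
Qed.

Lemma is_derive_comp_state (g : state -> R) x v : U x ->
  differentiable g (z x) ->
  is_derive x v (g \o z)
    (\sum_(i < M) d_dn i g (z x) * 'D_v (n i) x + d_dT g (z x) * 'D_v T x).
Proof.
move=> Ux dg.
have dz : differentiable z x by exact (differentiable_state_at n_C2 T_C1 Ux).
apply: DeriveDef; first exact/diff_derivable/differentiable_comp.
rewrite deriveE; last exact: differentiable_comp.
rewrite diff_comp//= -(deriveE _ dz) derive_state_at//.
(* Expansion in the canonical basis of the state space, on which the differential of [g] takes the
   values [d_dn i g] and [d_dT g]. *)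
have -> : (\row_i 'D_v (n i) x, 'D_v T x) =
    \sum_(i < M) 'D_v (n i) x *: ((delta_mx 0 i, 0) : state)
    + 'D_v T x *: ((0, 1) : state).
  apply: injective_projections.
    rewrite /= (raddf_sum fst) [LHS]row_sum_delta/= scaler0 addr0.
    by apply: eq_bigr => i _; rewrite mxE.
  rewrite /= (raddf_sum snd)/= big1 ?add0r => [|i _]; last exact: scaler0.
  by rewrite [RHS]mulr1.
rewrite linearD linear_sum linearZ /= -deriveE// mulrC; congr (_ + _).
by apply: eq_bigr => i _; rewrite linearZ /= -deriveE// mulrC.
Qed.

End Fluid.

(** * Derivatives of the free energy, the fluxes, the chemical potentials and the pressure *)

Section Korteweg.
Set Implicit Arguments.
Unset Strict Implicit.
Variables (R : realType) (M d : nat).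
Notation state := ('rV[R]_M * R)%type.
Variables (fb : state -> R) (c : 'I_M -> 'I_M -> state -> R).
Variables (n : 'I_M -> 'rV[R]_d -> R) (T : 'rV[R]_d -> R).
Variables (U : set 'rV[R]_d) (V : set state).
Hypothesis openU : open U.
Hypothesis UV : forall x, U x -> V (state_at n T x).
Hypothesis n_C3 : forall i, Ck 3 U (n i).
Hypothesis T_C2 : Ck 2 U T.
Hypothesis fb_C2 : Ck 2 V fb.
Hypothesis c_C2 : forall i j, Ck 2 V (c i j).
Hypothesis c_sym : forall i j z, V z -> c i j z = c j i z.

Let F : state -> 'M[R]_(M, d) -> R := helmholtz fb c.
Let z := state_at n T.
Let q := flux F n T.
Let G := grads_at n.

Let n_C2 i : Ck 2 U (n i). Proof. exact (CkS (n_C3 i)). Qed.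
Let T_C1 : Ck 1 U T. Proof. exact (CkS T_C2). Qed.
Let fb_C1 : Ck 1 V fb. Proof. exact (CkS fb_C2). Qed.
Let c_C1 i j : Ck 1 V (c i j). Proof. exact (CkS (c_C2 i j)). Qed.

Lemma near_open x : U x -> \forall y \near x, U y.
Proof. by move=> Ux; exact: open_nbhs_nbhs. Qed.

Lemma derivable_comp_state (g : state -> R) x v : Ck 1 V g -> U x ->
  derivable (fun y => g (z y)) x v.
Proof.
move=> gC1 Ux; have dg : differentiable g (z x) by exact/gC1.1/UV.
by have [] := is_derive_comp_state n_C2 T_C1 v Ux dg.
Qed.

Lemma derivable_partial i b x v : U x -> derivable (partial b (n i)) x v.
Proof. by move=> Ux; apply: diff_derivable; exact: ((n_C2 i).2 _).1. Qed.

Lemma flux_entryE i b x : U x ->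
  q i x 0 b = \sum_(j < M) c i j (z x) * partial b (n j) x.
Proof.
move=> Ux; rewrite /q (fluxE fb UV c_sym)// summxE.
by apply: eq_bigr => j _; rewrite !mxE.
Qed.

(** The explicit flux formula is known only on [U]; as [U] is open it holds near [x], which suffices
    for derivatives. *)
Lemma derivable_flux i b x v : U x -> derivable (fun y => q i y 0 b) x v.
Proof.
move=> Ux; apply: (@near_eq_derivable _ _ _
    (fun y => \sum_(j < M) c i j (z y) * partial b (n j) y)).
  by near=> y; rewrite flux_entryE//; near: y; exact: near_open.
apply: derivable_bigsum => j; apply: derivableM.
  exact (derivable_comp_state (c_C1 i j) Ux).
exact (derivable_partial Ux).
Unshelve. all: by end_near. Qed.

Lemma differentiable_helmholtz_state x (H : 'M[R]_(M, d)) : U x ->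
  differentiable (F^~ H) (z x).
Proof.
move=> Ux; apply: differentiableD; first exact/fb_C1.1/UV.
rewrite (_ : (fun _ => _) = 2^-1 *: \sum_(i < M) \sum_(j < M)
    (fun w => c i j w * dot (row i H) (row j H))); last first.
  apply/funext => w; rewrite /= fctE fct_sumE; congr (_ * _).
  by apply: eq_bigr => i _; rewrite fct_sumE.
apply: differentiableZ; apply: differentiable_sum => i.
apply: differentiable_sum => j; apply: differentiableM => //.
exact/(c_C1 i j).1/UV.
Qed.

Lemma is_derive_dot_grads x v i j : U x ->
  is_derive x v (fun y => dot (row i (G y)) (row j (G y)))
    (\sum_(b < d) (partial b (n i) x * 'D_v (partial b (n j)) x
                    + partial b (n j) x * 'D_v (partial b (n i)) x)).
Proof.
move=> Ux; rewrite /dot; under eq_fun do under eq_bigr do rewrite !mxE.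
by apply: is_derive_bigsum => b; apply: is_deriveM; apply/derivableP;
  exact: derivable_partial.
Qed.

(** Subtracting the energy with gradients frozen at [x] isolates the contribution of the varying
    gradients to the chain rule. *)
Lemma is_derive_helmholtz_grads x v : U x ->
  is_derive x v (fun y => F (z y) (G y) - F (z y) (G x))
    (\sum_(i < M) \sum_(b < d) q i x 0 b * 'D_v (partial b (n i)) x).
Proof.
move=> Ux.
have -> : (fun y => F (z y) (G y) - F (z y) (G x)) =
    (fun y => 2^-1 * \sum_(i < M) \sum_(j < M) c i j (z y) *
       (dot (row i (G y)) (row j (G y)) - dot (row i (G x)) (row j (G x)))).
  apply/funext => y; rewrite /F /helmholtz opprD addrACA subrr add0r -mulrBr.
  congr (_ * _); rewrite -sumrB; apply: eq_bigr => i _.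
  by rewrite -sumrB; apply: eq_bigr => j _; rewrite mulrBr.
have H i j := is_deriveM
  (derivableP (derivable_comp_state (v := v) (c_C1 i j) Ux))
  (is_deriveB (is_derive_dot_grads v i j Ux)
     (is_derive_cst (dot (row i (G x)) (row j (G x))) x v)).
apply: is_derive_eq.
  apply: is_derive_mull; apply: is_derive_bigsum => i.
  by apply: is_derive_bigsum => j; exact (H i j).
set S := RHS.
have ES : S = \sum_(i < M) \sum_(j < M) c i j (z x) *
    \sum_(b < d) partial b (n j) x * 'D_v (partial b (n i)) x.
  apply: eq_bigr => i _.
  under eq_bigr => b _ do rewrite flux_entryE// mulr_suml.
  rewrite exchange_big; apply: eq_bigr => j _; rewrite mulr_sumr.
  by apply: eq_bigr => b _; rewrite mulrA.
(* Exchanging [i] and [j] and using the symmetry of [c] moves the derivative to the other gradient.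
   The product rule produces the sum of both forms, that is [2 * S], which the factor [2^-1]
   compensates. *)
have ES' : S = \sum_(i < M) \sum_(j < M) c i j (z x) *
    \sum_(b < d) partial b (n i) x * 'D_v (partial b (n j)) x.
  rewrite ES [LHS]exchange_big; apply: eq_bigr => i _; apply: eq_bigr => j _.
  by rewrite (c_sym j i (UV Ux)).
rewrite -[RHS](mulKf (_ : 2 != 0 :> R)) ?pnatr_eq0//; congr (_ * _).
rewrite mulr_natl mulr2n {1}ES' ES -big_split; apply: eq_bigr => i _.
rewrite -big_split; apply: eq_bigr => j _ /=.
(* the difference of the two dot products vanishes at x, which kills the term
   containing the derivative of c i j \o z *)
by rewrite !fctE subrr scale0r addr0 subr0 big_split /= -mulrDr.
Qed.

(** With the gradients frozen the energy depends on the state alone, so its chain rule gives the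
    first two terms; the remainder gives the third. *)
Lemma is_derive_helmholtz_along x v : U x ->
  is_derive x v (fun y => F (z y) (G y))
    (\sum_(i < M) d_dn i (F^~ (G x)) (z x) * 'D_v (n i) x
     + d_dT (F^~ (G x)) (z x) * 'D_v T x
     + \sum_(i < M) \sum_(b < d) q i x 0 b * 'D_v (partial b (n i)) x).
Proof.
move=> Ux.
have -> : (fun y => F (z y) (G y)) =
    (fun y => F (z y) (G x)) + (fun y => F (z y) (G y) - F (z y) (G x)).
  by apply/funext => y; rewrite fctE addrC subrK.
apply: is_deriveD; last exact: is_derive_helmholtz_grads.
exact (is_derive_comp_state n_C2 T_C1 v Ux
  (differentiable_helmholtz_state (G x) Ux)).
Qed.

Lemma derive_flux i b x v : U x -> 'D_v (fun y => q i y 0 b) x =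
  \sum_(j < M) (c i j (z x) * 'D_v (partial b (n j)) x + partial b (n j) x *
    (\sum_(k < M) d_dn k (c i j) (z x) * 'D_v (n k) x
     + d_dT (c i j) (z x) * 'D_v T x)).
Proof.
move=> Ux; rewrite (@near_eq_derive _ _ _ _
    (fun y => \sum_(j < M) c i j (z y) * partial b (n j) y)); last first.
  by near=> y; rewrite flux_entryE//; near: y; exact: near_open.
apply: derive_val; apply: is_derive_bigsum => j.
apply: (@is_deriveM _ _ (c i j \o z)); last exact/derivableP/derivable_partial.
exact (is_derive_comp_state n_C2 T_C1 v Ux ((c_C1 i j).1 _ (UV Ux))).
Unshelve. all: by end_near. Qed.

(** Near [x], the potential is an explicit expression in first derivatives of [fb], [c] and [T] and
    at most second derivatives of [n]. One more derivative accounts for the classes [Ck 2] and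
    [Ck 3]. *)
Lemma derivable_chemical_potential i x v : U x ->
  derivable (chemical_potential F n T i) x v.
Proof.
move=> Ux; apply: derivableB.
  apply: (@near_eq_derivable _ _ _ (fun y => d_dn i fb (z y) + 2^-1 *
      \sum_(j < M) \sum_(k < M)
        d_dn i (c j k) (z y) * dot (row j (G y)) (row k (G y)))).
    near=> y; have Uy : U y by near: y; exact: near_open.
    by rewrite /d_dn (derive_helmholtz_state fb_C1 c_C1)//; exact: UV.
  apply: derivableD; first exact (derivable_comp_state (fb_C2.2 _) Ux).
  apply: (@derivableZ _ _ _ _ 2^-1).
  apply: derivable_bigsum => j; apply: derivable_bigsum => k.
  apply: derivableM; first exact (derivable_comp_state ((c_C2 j k).2 _) Ux).
  by have [] := is_derive_dot_grads v j k Ux.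
apply: derivable_bigsum => a; apply: (@near_eq_derivable _ _ _ (fun y =>
    \sum_(j < M) (c i j (z y) * partial a (partial a (n j)) y +
      partial a (n j) y * (\sum_(k < M) d_dn k (c i j) (z y) * partial a (n k) y
     + d_dT (c i j) (z y) * partial a T y)))).
  by near=> y; rewrite /partial derive_flux//; near: y; exact: near_open.
apply: derivable_bigsum => j; apply: derivableD; apply: derivableM.
- exact (derivable_comp_state (c_C1 i j) Ux).
- exact (diff_derivable ((((n_C3 j).2 _).2 _).1 x Ux)).
- exact (derivable_partial Ux).
apply: derivableD.
  apply: derivable_bigsum => k; apply: derivableM.
    exact (derivable_comp_state ((c_C2 i j).2 _) Ux).
  exact (derivable_partial Ux).
apply: derivableM; first exact (derivable_comp_state ((c_C2 i j).2 _) Ux).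
exact (diff_derivable ((T_C2.2 _).1 x Ux)).
Unshelve. all: by end_near. Qed.

(** Summing over [j] first turns the tensor into the outer product of [grad (n i)] and [q i]; the
    product rule does the rest. *)
Lemma sum_tensor_div_fluxE x i a : U x ->
  \sum_(j < M) tensor_div (fun y =>
     c i j (z y) *: outer (grad (n i) y) (grad (n j) y)) x 0 a =
  partial a (n i) x * div (q i) x
  + \sum_(b < d) q i x 0 b * partial b (partial a (n i)) x.
Proof.
move=> Ux; under eq_bigr do rewrite mxE; rewrite exchange_big /=.
rewrite /div mulr_sumr -big_split /=; apply: eq_bigr => b _.
have H j : derivable (fun y =>
    (c i j (z y) *: outer (grad (n i) y) (grad (n j) y)) a b) x
    (delta_mx 0 b).
  rewrite (_ : (fun _ => _) = (fun y => c i j (z y)) *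
      (partial a (n i) * partial b (n j))); last first.
    by apply/funext => y; rewrite !mxE.
  apply: derivableM; first exact (derivable_comp_state (c_C1 i j) Ux).
  by apply: derivableM; exact: derivable_partial.
have <- := derive_val (is_derive := is_derive_bigsum (fun j => derivableP (H j))).
rewrite (@near_eq_derive _ _ _ _ (partial a (n i) * (fun y => q i y 0 b))).
  exact (derive_val (is_derive := is_deriveM
    (derivableP (derivable_partial (i := i) (b := a) (v := delta_mx 0 b) Ux))
    (derivableP (derivable_flux (i := i) (b := b) (v := delta_mx 0 b) Ux)))).
near=> y; have Uy : U y by near: y; exact: near_open.
rewrite [RHS]/GRing.mul /= flux_entryE// mulr_sumr; apply: eq_bigr => j _.
by rewrite !mxE mulrCA.
Unshelve. all: by end_near. Qed.

(** In the product rule for [mu_i * n_i], the terms in [d_dn] cancel against those of the gradient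
    of the energy. The Hessian appears here in the order opposite to that in the tensor
    divergence. *)
Lemma grad_pressureE x a : U x ->
  grad (pressure F n T) x 0 a =
    \sum_(i < M) n i x * partial a (chemical_potential F n T i) x
    + entropy F n T x * partial a T x
    - \sum_(i < M) (partial a (n i) x * div (q i) x
        + \sum_(b < d) q i x 0 b * partial a (partial b (n i)) x).
Proof.
move=> Ux; rewrite mxE.
have H i := is_deriveM
  (derivableP (derivable_chemical_potential (i := i) (v := delta_mx 0 a) Ux))
  (derivableP (diff_derivable (v := delta_mx 0 a) ((n_C3 i).1 _ Ux))).
have := derive_val (is_derive := is_deriveB (is_derive_bigsum H)
  (is_derive_helmholtz_along (delta_mx 0 a) Ux)).
rewrite /partial => ->.
set e := delta_mx 0 a.
have -> : \sum_(i < M) (chemical_potential F n T i x *: 'D_e (n i) x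
      + n i x *: 'D_e (chemical_potential F n T i) x) =
    \sum_(i < M) d_dn i (F^~ (G x)) (z x) * 'D_e (n i) x
    - \sum_(i < M) 'D_e (n i) x * div (q i) x
    + \sum_(i < M) n i x * 'D_e (chemical_potential F n T i) x.
  rewrite big_split -sumrB; congr (_ + _); apply: eq_bigr => i _.
  by rewrite [in RHS](mulrC _ (div _ _)) -mulrBl.
rewrite [X in _ = _ - X]big_split.
(* Here [A] collects the [d_dn] terms that cancel, [B] the flux divergences, [C] the gradients of
   the potentials and [E'] the Hessian terms; [- t] is the entropy by definition. *)
have alg (A B C t T' E' : R) :
  A - B + C - (A + t * T' + E') = C + - t * T' - (B + E') by ring.
exact: alg.
Qed.

End Korteweg.

(** * The identity, component by component *)

Theorem mainTheorem2 (R : realType) (M d : nat)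
  (U : set 'rV[R]_d) (n : 'I_M -> 'rV[R]_d -> R) (T : 'rV[R]_d -> R)
  (V : set ('rV[R]_M * R))
  (fb : 'rV[R]_M * R -> R) (c : 'I_M -> 'I_M -> 'rV[R]_M * R -> R)
  (openU : open U) (openV : open V)
  (UV : forall x, U x -> V (state_at n T x))
  (n_C3 : forall i, Ck 3 U (n i)) (T_C2 : Ck 2 U T)
  (fb_C2 : Ck 2 V fb) (c_C2 : forall i j, Ck 2 V (c i j))
  (c_sym : forall i j z, V z -> c i j z = c j i z) :
  let f := helmholtz fb c in
  let mu := chemical_potential f n T in
  let s := entropy f n T in
  let p := pressure f n T in
  forall x, U x ->
    grad p x
    + \sum_(i < M) \sum_(j < M)
        tensor_div (fun y =>
          c i j (state_at n T y) *: outer (grad (n i) y) (grad (n j) y)) x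
    = \sum_(i < M) n i x *: grad (mu i) x + s x *: grad T x.
Proof.
move=> f mu s p x Ux; apply/rowP => a.
rewrite [LHS]mxE (grad_pressureE openU UV n_C3 T_C2 fb_C2 c_C2 c_sym)//.
rewrite !mxE !summxE.
have -> : \sum_(i < M) (n i x *: grad (mu i) x) 0 a =
    \sum_(i < M) n i x * partial a (mu i) x.
  by apply: eq_bigr => i _; rewrite !mxE.
(* The thermodynamic terms match; the tensor divergence has to offset the remainder of the pressure
   gradient, which is checked for each [i]. *)
rewrite -[RHS]addr0 -addrA; congr (_ + _).
apply/eqP; rewrite addrC subr_eq0; apply/eqP; apply: eq_bigr => i _.
rewrite summxE; apply: etrans
  (sum_tensor_div_fluxE fb openU UV n_C3 T_C2 c_C2 c_sym i a Ux) _.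
apply: (congr1 (+%R _)); apply: eq_bigr => b _; apply: (congr1 ( *%R _)).
(* The two sides differ only in the order of the second derivatives of [n i]. *)
exact (Ck_derive_symmetric _ _ openU (CkS (n_C3 i)) Ux).
Qed.
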